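(* Let $n$ be a positive integer, and let $\alpha=\nu_2(n)$ and $\beta=\nu_3(n)$. Let $r,s,t$ be positive integers. Then the following hold in $\mathbb{Z}[q]$. (1) $$\genfrac{[}{]}{0pt}{}{6n}{n}_q^{-1}\sum_{k=-n}^{n}(-1)^kq^{\binom{k}{2}}\genfrac{[}{]}{0pt}{}{6n}{3n+k}_q^r\genfrac{[}{]}{0pt}{}{4n}{2n+k}_q^s\genfrac{[}{]}{0pt}{}{2n}{n+k}_q^t\equiv 0\pmod{[2]_{q^{2^\alpha}}}.$$ (2) $$\genfrac{[}{]}{0pt}{}{6n}{3n}_q^{-1}\sum_{k=-n}^{n}(-1)^kq^{\binom{k}{2}}\genfrac{[}{]}{0pt}{}{6n}{3n+k}_q^r\genfrac{[}{]}{0pt}{}{4n}{2n+k}_q^s\genfrac{[}{]}{0pt}{}{2n}{n+k}_q^t\equiv 0\pmod{[2]_{q^{2^\alpha}}[3]_{q^{3^\beta}}}.$$ (3) Put $$Q(q)=\genfrac{[}{]}{0pt}{}{8n}{3n}_q^{-1}\sum_{k=-n}^{n}(-1)^kq^{\binom{k}{2}}\genfrac{[}{]}{0pt}{}{8n}{4n+k}_q^r\genfrac{[}{]}{0pt}{}{4n}{2n+k}_q^s\genfrac{[}{]}{0pt}{}{2n}{n+k}_q^t.$$ Then: - if $t\geq 2$, then $Q(q)\equiv 0\pmod{[2]_{q^{2^\alpha}}}$; - if $s\geq 2$, or if $r\geq 2$ and $n\equiv 3\cdot 2^\alpha\pmod{2^{\alpha+2}}$, then $Q(q)\equiv 0\pmod{[2]_{q^{2^{\alpha+1}}}}$;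 - if $r\geq 2$ and $n\equiv 2^\alpha\pmod{2^{\alpha+2}}$, then $Q(q)\equiv 0\pmod{[2]_{q^{2^{\alpha+2}}}}$.
   Context: For a prime $p$ and a nonzero integer $m$, $\nu_p(m)$ is the greatest integer such that $p^{\nu_p(m)}\mid m$. For a positive integer $m$, $[m]_q=\frac{1-q^m}{1-q}=1+q+\cdots+q^{m-1}$, and $[m]_{q^a}$ denotes the result of replacing $q$ by $q^a$ in it, e.g. $[2]_{q^a}=1+q^a$ and $[3]_{q^a}=1+q^a+q^{2a}$. The $q$-binomial coefficient is $\genfrac{[}{]}{0pt}{}{m}{k}_q=\prod_{j=1}^k\frac{1-q^{m+1-j}}{1-q^j}$ if $m\geq k\geq 1$, equal to $1$ if $k=0$, and equal to $0$ if $k<0$ or $k>m$; it is a polynomial in $\mathbb{Z}[q]$. Here $\binom{k}{2}=k(k-1)/2$ for every integer $k$ (including negative $k$). A congruence of the form $B(q)^{-1}S(q)\equiv 0\pmod{M(q)}$ means that $S(q)=H(q)M(q)B(q)$ for some $H(q)\in\mathbb{Z}[q]$. *)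

(* Defs.v *)
From HB Require Import structures.
From mathcomp Require Export all_boot all_order all_algebra.
From mathcomp Require Import zify ring.
Set Implicit Arguments.
Unset Strict Implicit.
Unset Printing Implicit Defensive.
Import GRing.Theory Num.Theory.
Local Open Scope ring_scope.

(* The indeterminate q is 'X in {poly int}. *)

Definition qnat (m : nat) : {poly int} := \sum_(i < m) 'X^i.

Definition qnat_pow (m a : nat) : {poly int} := qnat m \Po 'X^a.

(* The leading coefficient of the divisor is +1 or -1, so %/ is Euclidean
   division in {poly int}; it is exact by qbinE below.  For k = 0 both products
   are empty and the value is 1 (qbin0). *)
Definition qbin (m : nat) (k : int) : {poly int} :=
  match k with
  | Posz k' =>
      if (k' <= m)%N then
        (\prod_(1 <= j < k'.+1) (1 - 'X^(m.+1 - j)))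
          %/ (\prod_(1 <= j < k'.+1) (1 - 'X^j))
      else 0
  | Negz _ => 0
  end.

(* k (k - 1) / 2 for every integer k; the value is never negative (zbin2E), so
   taking the absolute value only casts it to nat. *)
Definition zbin2 (k : int) : nat := `|((k * (k - 1)) %/ 2)%Z|%N.

(* The integers -n, ..., n. *)
Definition symrange (n : nat) : seq int :=
  [seq i%:Z - n%:Z | i <- iota 0 (2 * n).+1].

(* B(q)^-1 S(q) = 0 (mod M(q)) in Z[q]. *)
Definition qdiv_congr0 (B S M : {poly int}) : Prop :=
  exists H : {poly int}, S = H * M * B.

Lemma mem_symrange n (k : int) : (k \in symrange n) = (- n%:Z <= k <= n%:Z).
Proof.
apply/mapP/idP => [[i] | Hk]; first by rewrite mem_iota => /andP[_ Hi] ->; lia.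
by exists `|(k + n%:Z)%R|%N; rewrite ?mem_iota; lia.
Qed.

Lemma zbin2E (k : int) : (zbin2 k)%:Z * 2 = k * (k - 1).
Proof.
have ev : (2 %| k * (k - 1))%Z.
  have [j [->|->]] : exists j : int, k = j * 2 \/ k = j * 2 + 1.
  - by exists (k %/ 2)%Z; lia.
  - by rewrite -mulrA [2 * _]mulrC mulrA dvdz_mull.
  - by rewrite addrK mulrA dvdz_mull.
rewrite /zbin2 gez0_abs ?divzK // divz_ge0 //.
have [?|?] : k <= 0 \/ 1 <= k by lia.
  by nia.
by nia.
Qed.

Lemma qnat_powE (m a : nat) : qnat_pow m a = \sum_(i < m) 'X^(a * i).
Proof.
rewrite /qnat_pow /qnat linear_sum /=; apply: eq_bigr => i _.
by rewrite comp_Xn_poly -exprM.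
Qed.

Lemma qbin0 (m : nat) : qbin m 0 = 1.
Proof. by rewrite /qbin /= !big_nil Pdiv.Idomain.divp1. Qed.

Lemma qbin_dvd (m k : nat) : exists g : {poly int},
  \prod_(1 <= j < k.+1) (1 - 'X^(m.+1 - j))
    = g * \prod_(1 <= j < k.+1) (1 - 'X^j).
Proof.
rewrite !big_add1 /=.
under eq_bigr do rewrite subSS.
elim: m k => [|m IHm] [|k].
- by exists 1; rewrite !big_nil mulr1.
- by exists 0; rewrite big_nat_recl //= sub0n expr0 subrr !mul0r.
- by exists 1; rewrite !big_nil mulr1.
have [g Hg] := IHm k; have [h Hh] := IHm k.+1.
exists (g + 'X^(k.+1) * h); rewrite mulrDl -mulrA -Hh.
rewrite big_nat_recl // subn0; under eq_bigr do rewrite subSS.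
rewrite [in X in _ = g * X + _]big_nat_recr //= mulrA -Hg.
rewrite [in X in _ = _ + 'X^_ * X]big_nat_recr //=.
case: (leqP k m) => km.
  have -> : 'X^(m.+1) = 'X^(k.+1) * 'X^(m - k) :> {poly int}.
    by rewrite -exprD addSn subnKC.
  by ring.
have -> : \prod_(0 <= i < k) (1 - 'X^(m - i)) = 0 :> {poly int}.
  apply/eqP; rewrite big_mkord prodf_seq_eq0; apply/hasP.
  by exists (Ordinal km); rewrite ?mem_index_enum //= subnn expr0 subrr.
by ring.
Qed.

Lemma qbinE (m k : nat) : (k <= m)%N ->
  qbin m k * \prod_(1 <= j < k.+1) (1 - 'X^j)
    = \prod_(1 <= j < k.+1) (1 - 'X^(m.+1 - j)).
Proof.
move=> km; rewrite /qbin km; have [g ->] := qbin_dvd m k.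
rewrite Pdiv.IdomainUnit.mulpK // lead_coef_prod.
rewrite big_nat; apply: rpred_prod => j /andP[j_gt0 _].
by rewrite lead_coefDr ?lead_coefN ?lead_coefXn // size_polyN size_polyXn size_poly1.
Qed.

(* Main.v *)
Require Import Defs.
From mathcomp Require Import all_boot all_order all_algebra all_field.
From mathcomp Require Import zify ring.
Set Implicit Arguments.
Unset Strict Implicit.
Unset Printing Implicit Defensive.
Import GRing.Theory Num.Theory.
Local Open Scope ring_scope.

(** Both sides are compared root by root over the algebraic numbers. Let z be a
    primitive d-th root of unity. The multiplicity of z in the q-binomial
    coefficient [m; k] is the carry (0 or 1) of the addition k + (m - k) modulo d.
    Grouping the summands for k and - k produces a factor 1 + q^k, which vanishes
    at z when k = d/2 modulo d. If z is a root of the q-binomial coefficient on the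
    left, then either every summand vanishes at z, or 3n (resp. 4n), 2n and n all
    have residue at least d/2 modulo d. In the latter case q-Lucas shows that
    keeping k mod d and sending its quotient l to -1 - l changes the sign of
    every summand at z, so the sum vanishes. At the order d attached to the factor
    [2] of the modulus the same count, with the factor 1 + q^k, gives
    multiplicity two. *)

(** * Divisibility in Z[q] from root multiplicities over the algebraic numbers *)

Local Notation zmap := (map_poly (intr : int -> algC)).

(** Over an algebraically closed field a nonconstant P has a root, shared with S; cancelling the
    common linear factor lowers both multiplicities at that point by one. *)
Lemma dvdp_of_mup (P S : {poly algC}) : P != 0 -> S != 0 ->
  (forall z, (mup z P <= mup z S)%N) -> P %| S.
Proof.
move: {2}(size P) (leqnn (size P)) => n.
elim: n P S => [|n IH] P S sP P0 S0 le_mup.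
  by rewrite leqn0 size_poly_eq0 (negPf P0) in sP.
have [sP1 | /closed_rootP[z rz]] := boolP (size P == 1%N).
  by rewrite (@eqp_dvdl _ 1) ?dvd1p // -size_poly_eq1.
have rS : root S z.
  rewrite -dvdp_XsubCl XsubC_dvd // (leq_trans _ (le_mup z)) //.
  by rewrite -XsubC_dvd // dvdp_XsubCl.
have /factor_theorem[P1 P1E] := rz; have /factor_theorem[S1 S1E] := rS.
have P10 : P1 != 0 by apply: contraNneq P0 => P10; rewrite P1E P10 mul0r.
have S10 : S1 != 0 by apply: contraNneq S0 => S10; rewrite S1E S10 mul0r.
rewrite P1E S1E dvdp_mul2r ?polyXsubC_eq0 //; apply: IH => // [|y].
  by move: sP; rewrite P1E size_Mmonic ?monicXsubC // size_XsubC addn2.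
by move: (le_mup y); rewrite P1E S1E !mupM ?polyXsubC_eq0 // leq_add2r.
Qed.

Lemma size_zmap p : size (zmap p) = size p.
Proof.
have [->|p0] := eqVneq p 0; first by rewrite rmorph0 !size_poly0.
by apply: size_map_poly_id0; rewrite intr_eq0 lead_coef_eq0.
Qed.

Lemma zmap_eq0 p : (zmap p == 0) = (p == 0).
Proof. by rewrite -!size_poly_eq0 size_zmap. Qed.

(** A unit leading coefficient allows Euclidean division by P in Z[q]. Over [algC] the remainder is
    a multiple of P of smaller size, hence zero. S = 0 is trivially divisible, so the bound is only
    asked for nonzero S. *)
Lemma zdvd_of_mup (P S : {poly int}) : lead_coef P \is a GRing.unit ->
  (forall z, S != 0 -> (mup z (zmap P) <= mup z (zmap S))%N) ->
  exists H, S = H * P.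
Proof.
move=> uP le_mup; have [->|S0] := eqVneq S 0; first by exists 0; rewrite mul0r.
have P0 : P != 0 by rewrite -lead_coef_eq0; apply: contraTneq uP => ->; rewrite unitr0.
have dPS : zmap P %| zmap S.
  by apply: dvdp_of_mup; rewrite ?zmap_eq0 // => z; apply: le_mup.
exists (S %/ P); rewrite {1}(Pdiv.IdomainUnit.divp_eq uP S).
suff -> : S %% P = 0 by rewrite addr0.
apply/eqP; rewrite -zmap_eq0 -size_poly_eq0 -leqn0.
have lt : (size (zmap (S %% P)) < size (zmap P))%N.
  by rewrite !size_zmap ltn_modp.
have dR : zmap P %| zmap (S %% P).
  have := dPS; rewrite {1}(Pdiv.IdomainUnit.divp_eq uP S) rmorphD rmorphM /=.
  by rewrite dvdp_addr // dvdp_mull.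
rewrite leqNgt size_poly_gt0; apply/negP => R0.
by have := dvdp_leq R0 dR; rewrite leqNgt lt.
Qed.

(** The roots are simple: a double root would kill the derivative - j X^(j-1), forcing z = 0. *)
Lemma mup_1subXn z j : (0 < j)%N -> mup z (1 - 'X^j : {poly algC}) = (z ^+ j == 1).
Proof.
move=> j0; set p := (X in mup z X).
have rp : root p z = (z ^+ j == 1).
  by rewrite /root /p !hornerE subr_eq0 eq_sym.
have p0 : p != 0.
  rewrite -size_poly_eq0 /p -opprB size_polyN size_XnsubC // .
case: (boolP (z ^+ j == 1)) => zj; last by rewrite mupNroot ?rp.
apply/eqP; rewrite eqn_leq -XsubC_dvd // dvdp_XsubCl rp zj andbT mup_leq //.
apply/negP => /dvdpP[q pE].
have : p^`().[z] = 0.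
  rewrite pE expr2 mulrA derivM derivXsubC mulr1 hornerD hornerM [(q * _).[z]]hornerM.
  by rewrite !hornerXsubC subrr !mulr0 addr0.
rewrite /p derivB (derivC 1) derivXn sub0r hornerN => /eqP.
rewrite oppr_eq0 hornerMn hornerXn mulrn_eq0 -leqn0 leqNgt j0 /= expf_eq0.
case/andP=> _ /eqP z0; move: zj; rewrite z0 expr0n -leqn0 leqNgt j0 eq_sym.
by rewrite oner_eq0.
Qed.

Lemma prim_root_neq0 d (z : algC) : d.-primitive_root z -> z != 0.
Proof.
move=> zP; apply: contraTneq (oner_neq0 algC) => z0.
by rewrite -(prim_expr_order zP) z0 expr0n eqn0Ngt (prim_order_gt0 zP) eqxx.
Qed.

Lemma lead_unit_1subXn j : (0 < j)%N ->
  lead_coef (1 - 'X^j : {poly int}) \is a GRing.unit.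
Proof.
move=> j0; rewrite lead_coefDr ?lead_coefN ?lead_coefXn //.
by rewrite size_polyN size_polyXn size_poly1.
Qed.

(** * q-binomial coefficients and the multiplicities of their roots *)

Definition qpoch (m : nat) : {poly int} := \prod_(1 <= j < m.+1) (1 - 'X^j).

Lemma qpochS m : qpoch m.+1 = qpoch m * (1 - 'X^(m.+1)).
Proof. by rewrite /qpoch big_nat_recr. Qed.

Lemma qpoch_lead_unit m : lead_coef (qpoch m) \is a GRing.unit.
Proof.
rewrite lead_coef_prod big_nat; apply: rpred_prod => j /andP[j_gt0 _].
exact: lead_unit_1subXn.
Qed.

Lemma lead_unit_neq0 (p : {poly int}) : lead_coef p \is a GRing.unit -> p != 0.
Proof. by apply: contraTneq => ->; rewrite lead_coef0 unitr0. Qed.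

Lemma qpoch_neq0 m : qpoch m != 0.
Proof. exact/lead_unit_neq0/qpoch_lead_unit. Qed.

Lemma qbin_qpoch m k : (k <= m)%N ->
  qbin m k%:Z * qpoch k * qpoch (m - k) = qpoch m.
Proof.
move=> km; rewrite /qpoch qbinE // -/(qpoch _) -/(qpoch _).
elim: k km => [|k IH] km; first by rewrite big_nil mul1r subn0.
rewrite -(IH (ltnW km)) big_nat_recr //= subSS -mulrA; congr (_ * _).
by rewrite -(subnSK km) qpochS mulrC.
Qed.

Lemma qbin_lead_unit m k : (k <= m)%N -> lead_coef (qbin m k%:Z) \is a GRing.unit.
Proof.
move=> /qbin_qpoch E; have := qpoch_lead_unit m.
by rewrite -E !lead_coefM !unitrM => /andP[/andP[]].
Qed.

Lemma qbin_neq0 m k : (k <= m)%N -> qbin m k%:Z != 0.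
Proof. by move=> /qbin_lead_unit/lead_unit_neq0. Qed.

Lemma qbin_gt m k : (m < k)%N -> qbin m k%:Z = 0.
Proof. by rewrite /qbin ltnNge => /negPf ->. Qed.

Lemma qbin_sub m k : (k <= m)%N -> qbin m (m - k)%:Z = qbin m k%:Z.
Proof.
move=> km; have E1 := qbin_qpoch km; have := qbin_qpoch (leq_subr k m).
rewrite -E1 subKn // mulrAC => /(mulIf (qpoch_neq0 _)).
exact: (mulIf (qpoch_neq0 _)).
Qed.

Lemma qbinn m : qbin m m%:Z = 1.
Proof. by rewrite -(qbin_sub (leqnn m)) subnn qbin0. Qed.

Lemma qbinS m k :
  qbin m.+1 k.+1%:Z = 'X^(k.+1) * qbin m k.+1%:Z + qbin m k%:Z.
Proof.
case: (ltngtP k m) => [km|km|->]; last 1 first.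
- by rewrite !qbinn qbin_gt // mulr0 add0r.
- apply: (mulIf (qpoch_neq0 k.+1)); apply: (mulIf (qpoch_neq0 (m - k))).
  have E1 : qbin m.+1 k.+1%:Z * qpoch k.+1 * qpoch (m - k) = qpoch m.+1.
    by rewrite -[(m - k)%N]subSS qbin_qpoch // ltnS ltnW.
  rewrite E1 mulrDl mulrDl.
  have -> : 'X^(k.+1) * qbin m k.+1%:Z * qpoch k.+1 * qpoch (m - k)
          = 'X^(k.+1) * (1 - 'X^(m - k)) * qpoch m.
    rewrite -(qbin_qpoch km) -(subnSK km) [qpoch (m - k.+1).+1]qpochS; ring.
  have -> : qbin m k%:Z * qpoch k.+1 * qpoch (m - k) = (1 - 'X^(k.+1)) * qpoch m.
    rewrite -(qbin_qpoch (ltnW km)) qpochS; ring.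
  rewrite qpochS; have -> : m.+1 = (k.+1 + (m - k))%N by lia.
  rewrite exprD; ring.
- by rewrite !qbin_gt // ?mulr0 ?addr0 //; lia.
Qed.

Lemma mup_qpoch d z m : d.-primitive_root z -> mup z (zmap (qpoch m)) = (m %/ d)%N.
Proof.
move=> zP; elim: m => [|m IH].
  by rewrite /qpoch big_nil rmorph1 mupNroot ?root1 ?div0n.
rewrite qpochS rmorphM mupM ?zmap_eq0 ?qpoch_neq0 //; last first.
  by have := qpoch_neq0 m.+1; rewrite qpochS mulf_eq0 negb_or => /andP[].
rewrite IH rmorphB rmorph1 /= map_polyXn mup_1subXn // -(prim_order_dvd zP).
by rewrite divnS ?(prim_order_gt0 zP) // addnC.
Qed.

(** Counting the factors 1 - q^j with d dividing j gives m/d - k/d - (m-k)/d with integer quotients,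
    which is the carry of k + (m - k) modulo d. *)
Lemma mup_qbin d z m k : d.-primitive_root z -> (k <= m)%N ->
  mup z (zmap (qbin m k%:Z)) = (d <= k %% d + (m - k) %% d)%N.
Proof.
move=> zP km; have := mup_qpoch m zP; rewrite -(qbin_qpoch km) !rmorphM /=.
rewrite !mupM ?mulf_neq0 ?zmap_eq0 ?qpoch_neq0 ?qbin_neq0 // !(mup_qpoch _ zP).
have := divnD k (m - k) (prim_order_gt0 zP); rewrite subnKC // => ->.
by rewrite -addnA addnC => /addnI.
Qed.

Lemma mup_qpoch_prim z m : (0 < mup z (zmap (qpoch m)))%N ->
  exists d, d.-primitive_root z.
Proof.
elim: m => [|m IH]; first by rewrite /qpoch big_nil rmorph1 mupNroot ?root1.
rewrite qpochS rmorphM mupM ?zmap_eq0 ?qpoch_neq0 //; last first.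
  by have := qpoch_neq0 m.+1; rewrite qpochS mulf_eq0 negb_or => /andP[].
rewrite addn_gt0 => /orP[//|]; rewrite rmorphB rmorph1 /= map_polyXn mup_1subXn //.
by rewrite lt0b => /eqP /(prim_order_exists (ltn0Sn m)) [d dP _]; exists d.
Qed.

Lemma mup_qbin_prim z m k : (k <= m)%N -> (0 < mup z (zmap (qbin m k%:Z)))%N ->
  exists d, d.-primitive_root z.
Proof.
move=> km gt0; apply: (@mup_qpoch_prim z m); apply: leq_trans gt0 _.
rewrite -(qbin_qpoch km) -mulrA rmorphM mupM ?leq_addr //.
  by rewrite zmap_eq0 qbin_neq0.
by rewrite zmap_eq0 mulf_neq0 ?qpoch_neq0.
Qed.

(** * q-Lucas: values of q-binomial coefficients at a root of unity *)

Definition qbin_at (z : algC) m (k : int) : algC := (zmap (qbin m k)).[z].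

Lemma qbin_at_lt0 z m k : k < 0 -> qbin_at z m k = 0.
Proof. by case: k => // k _; rewrite /qbin_at rmorph0 horner0. Qed.

Lemma qbin_at_gt z m k : m%:Z < k -> qbin_at z m k = 0.
Proof. by case: k => // k km; rewrite /qbin_at qbin_gt ?rmorph0 ?horner0 //; lia. Qed.

Lemma qbin_atS z m k : z != 0 ->
  qbin_at z m.+1 k = z ^ k * qbin_at z m k + qbin_at z m (k - 1).
Proof.
move=> z0; case: k => [[|k]|k].
- by rewrite (@qbin_at_lt0 _ _ (0 - 1)) // /qbin_at !qbin0 expr0z mul1r addr0.
- have -> : k.+1%:Z - 1 = k by lia.
  by rewrite /qbin_at qbinS rmorphD rmorphM /= map_polyXn !hornerE.
- by rewrite !qbin_at_lt0 ?mulr0 ?addr0 //; lia.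
Qed.

(** An additive form of q-Lucas: raising the upper quotient by one acts as Pascal's rule on the
    quotients. For m = 0 it holds because [d; k] vanishes at z for 0 < k < d; the induction uses
    q-Pascal, whose weights z^k and z^(k-d) agree. *)
Lemma qbin_at_period d z m k : d.-primitive_root z ->
  qbin_at z (m + d) k = qbin_at z m k + qbin_at z m (k - d%:Z).
Proof.
move=> zP; have d0 := prim_order_gt0 zP.
have z0 := prim_root_neq0 zP.
have zd : z ^ d%:Z = 1 by exact: prim_expr_order zP.
elim: m k => [|m IH] k.
  have E0 j : qbin_at z 0 j = (j == 0)%:R.
    have [->|j0] := eqVneq j 0; first by rewrite /qbin_at qbin0 rmorph1 hornerE.
    by case: (ltrgtP j 0) j0 => // jl _; [rewrite qbin_at_lt0 | rewrite qbin_at_gt].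
  rewrite add0n !E0; case: (ltrgtP k 0) => [k0|k0|->].
  - by rewrite qbin_at_lt0 // (_ : _ == _ = false) ?addr0 //; lia.
  - rewrite add0r; case: (ltrgtP k d%:Z) => [kd|kd|->].
    + rewrite (_ : _ == _ = false); last by lia.
      case: k k0 kd => // k k0 kd; apply/eqP; rewrite -[_ == _]/(root _ z).
      have kd' : (k < d)%N by lia.
      have kd2 := ltnW kd'.
      rewrite -dvdp_XsubCl XsubC_dvd ?zmap_eq0 ?qbin_neq0 // (mup_qbin zP) //.
      by rewrite !modn_small ?subnKC ?leqnn //; lia.
    + by rewrite qbin_at_gt // (_ : _ == _ = false) //; lia.
    + by rewrite subrr eqxx /qbin_at qbinn rmorph1 hornerE.
  - by rewrite (_ : 0 - _ == _ = false) ?addr0 /qbin_at ?qbin0 ?rmorph1 ?hornerE //; lia.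
rewrite addSn !qbin_atS // !IH (_ : k - 1 - d%:Z = k - d%:Z - 1); last by ring.
rewrite expfzDr // -invr_expz zd invr1 mulr1; ring.
Qed.

Lemma qbin_at_small z d b f (c : int) : (b < d)%N -> (f < d)%N -> c != 0 ->
  qbin_at z b (c * d%:Z + f%:Z) = 0.
Proof.
move=> bd fd c0; have [cl|cg] : c <= -1 \/ 1 <= c by lia.
  by apply: qbin_at_lt0; nia.
by apply: qbin_at_gt; nia.
Qed.

(* At a primitive d-th root of unity the q-Lucas theorem turns the q-binomial
   coefficient with quotients (a, c) into a multiple of 'C(a, c): the next lemma
   is the symmetry of 'C(a, c) under c |-> a - c. *)
Lemma qbin_at_mirror d z a b f (c : int) :
  d.-primitive_root z -> (b < d)%N -> (f < d)%N ->
  qbin_at z (a * d + b) ((a%:Z - c) * d%:Z + f%:Z)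
  = qbin_at z (a * d + b) (c * d%:Z + f%:Z).
Proof.
move=> zP bd fd; elim: a c => [|a IH] c.
  have [->|c0] := eqVneq c 0; first by rewrite subr0.
  by rewrite mul0n add0n !(@qbin_at_small _ d) // sub0r oppr_eq0.
rewrite (_ : (a.+1 * d + b = a * d + b + d)%N); last by lia.
rewrite !(qbin_at_period _ _ zP).
rewrite (_ : (a.+1%:Z - c) * d%:Z + f%:Z = (a%:Z - (c - 1)) * d%:Z + f%:Z); last by lia.
rewrite IH (_ : _ - d%:Z = (a%:Z - c) * d%:Z + f%:Z); last by lia.
rewrite IH addrC; congr (_ + qbin_at _ _ _); lia.
Qed.

(** In q-Lucas the factor of the residues is [b; f], which is zero for b < f. *)
Lemma qbin_at_eq0 d z a b f (c : int) :
  d.-primitive_root z -> (b < f)%N -> (f < d)%N ->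
  qbin_at z (a * d + b) (c * d%:Z + f%:Z) = 0.
Proof.
move=> zP bf fd; elim: a c => [|a IH] c.
  rewrite mul0n add0n; have [->|c0] := eqVneq c 0; last first.
    by rewrite (@qbin_at_small _ d) // (ltn_trans bf).
  by rewrite mul0r add0r qbin_at_gt.
rewrite (_ : (a.+1 * d + b = a * d + b + d)%N); last by lia.
rewrite (qbin_at_period _ _ zP) IH add0r.
by rewrite (_ : _ - _ = (c - 1) * d%:Z + f%:Z) ?IH //; lia.
Qed.

Definition quot_flip (d : nat) (k : int) : int :=
  (-1 - (k %/ d)%Z) * d%:Z + (k %% d)%Z.

(** Write a = u d + v and k = l d + kap. As 2v is at least d, 2a has quotient 2u + 1 and residue 2v
    - d. If v + kap < d, the lower residue v + kap exceeds 2v - d and both sides vanish. Otherwise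
    the lower quotients are u - l and u + l + 1, whose sum is 2u + 1, and [qbin_at_mirror]
    applies. *)
Lemma qbin_at_flip d z a k : d.-primitive_root z -> (d <= 2 * (a %% d))%N ->
  qbin_at z (2 * a) (a%:Z + quot_flip d k) = qbin_at z (2 * a) (a%:Z + k).
Proof.
move=> zP hv; have d0 := prim_order_gt0 zP.
have [l [kap [kE kd]]] : exists l kap, k = l * d%:Z + kap%:Z /\ (kap < d)%N.
  exists (k %/ d)%Z, `|(k %% d)%Z|%N; split.
    by rewrite gez0_abs ?modz_ge0 -?divz_eq //; lia.
  have := ltz_pmod k (d := d%:Z) d0; have := modz_ge0 k (d := d%:Z); lia.
have -> : quot_flip d k = (-1 - l) * d%:Z + kap%:Z.
  have d1 : d%:Z != 0 by lia.
  rewrite /quot_flip kE divzMDl // modzMDl divz_small ?modz_small ?addr0 //; lia.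
have := ltn_pmod a d0; have := divn_eq a d.
move: (a %/ d)%N (a %% d)%N hv => u v hv -> {a} vd; rewrite {}kE.
have -> : (2 * (u * d + v) = (2 * u + 1) * d + (2 * v - d))%N by lia.
have [lt|ge] := ltnP (v + kap)%N d.
  rewrite (_ : _ + ((-1 - l) * _ + _) 
    = (u%:Z - 1 - l) * d%:Z + (v + kap)%N%:Z); last by lia.
  rewrite (_ : _ + (l * _ + _) = (u%:Z + l) * d%:Z + (v + kap)%N%:Z); last by lia.
  by rewrite !(qbin_at_eq0 _ _ zP) //; lia.
rewrite (_ : _ + ((-1 - l) * _ + _)
  = ((2 * u + 1)%N%:Z - (u%:Z + l + 1)) * d%:Z + (v + kap - d)%N%:Z); last by lia.
rewrite (_ : _ + (l * _ + _) = (u%:Z + l + 1) * d%:Z + (v + kap - d)%N%:Z); last by lia.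
by rewrite (qbin_at_mirror _ _ zP) //; lia.
Qed.

(** * The sign and power of q in front of each summand *)

Lemma signz (R : unitRingType) (k : int) : (-1) ^ k = (-1) ^+ `|k|%N :> R.
Proof. by case: k => k //; rewrite NegzE -exprz_inv invrN1. Qed.

Definition qsign (z : algC) (k : int) : algC := (-1) ^ k * z ^+ zbin2 k.

(** The exponent grows by dk + d(d-1)/2, so the claim is (-1)^d z^(d(d-1)/2) = -1. For odd d the
    exponent is a multiple of d; for even d, z^(d/2) = -1 gives (-1)^(d + d - 1). *)
Lemma qsign_shift d z k : d.-primitive_root z -> qsign z (k + d%:Z) = - qsign z k.
Proof.
move=> zP; have d0 := prim_order_gt0 zP.
have z0 := prim_root_neq0 zP.
have zd : z ^ d%:Z = 1 by exact: prim_expr_order zP.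
have m1 : (-1 : algC) != 0 by rewrite oppr_eq0 oner_eq0.
have E : (zbin2 (k + d%:Z))%:Z = (zbin2 k)%:Z + (d%:Z * k + (zbin2 d)%:Z).
  have := zbin2E (k + d%:Z); have := zbin2E k; have := zbin2E d; nia.
have half : (-1) ^ d%:Z * z ^ (zbin2 d)%:Z = -1 :> algC.
  have Ed := zbin2E d.
  have [e [dE|dE]] : exists e : nat, d = (e.*2)%N \/ d = e.*2.+1%N.
  - by exists d./2; lia.
  - have -> : zbin2 d = (e * d.-1)%N by nia.
    have ze : z ^+ e = -1.
      have : (z ^+ e) ^+ 2 == 1 by rewrite -exprM muln2 -dE prim_expr_order.
      rewrite sqrf_eq1 => /orP[|/eqP//]; rewrite -(prim_order_dvd zP).
      by move=> /dvdn_leq; lia.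
    rewrite -!exprnP exprM ze -exprD dE -signr_odd; have -> : odd (e.*2 + e.*2.-1) by lia.
    by rewrite expr1.
  - have -> : zbin2 d = (d * e)%N by nia.
    rewrite -!exprnP exprM (prim_expr_order zP) expr1n mulr1 dE.
    by rewrite -signr_odd /= odd_double expr1.
rewrite /qsign !exprnP E !expfzDr // -exprz_exp zd exp1rz mul1r.
rewrite mulrACA half; ring.
Qed.

Lemma qsign_shifts d z k (j : int) : d.-primitive_root z ->
  qsign z (k + j * d%:Z) = (-1) ^ j * qsign z k.
Proof.
move=> zP; have nat_case (i : nat) k' :
    qsign z (k' + i%:Z * d%:Z) = (-1) ^+ i * qsign z k'.
  elim: i => [|i IH]; first by rewrite mul0r addr0 mul1r.
  rewrite (_ : _ + _ = k' + i%:Z * d%:Z + d%:Z); last by lia.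
  by rewrite (qsign_shift _ zP) IH exprS; ring.
case: j => j; first by rewrite nat_case.
rewrite -[k in RHS](subrK (j.+1%:Z * d%:Z)) nat_case signz mulrA -exprD.
rewrite -signr_odd (_ : odd _ = false) ?mul1r; last by rewrite oddD /= addbb.
congr qsign; lia.
Qed.

(** The flip moves k by -1 - 2l periods, an odd number. *)
Lemma qsign_flip d z k : d.-primitive_root z ->
  qsign z (quot_flip d k) = - qsign z k.
Proof.
move=> zP; set l := (k %/ d)%Z.
have -> : quot_flip d k = k + (-1 - 2 * l) * d%:Z.
  by rewrite /quot_flip {3}(divz_eq k d) -/l; lia.
rewrite (qsign_shifts _ _ zP) signz -signr_odd (_ : odd _) ?mulN1r //; lia.
Qed.

(** * Sums over the integers -n, ..., n *)

Lemma big_symrange_nat (V : zmodType) n (F : int -> V) :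
  \sum_(k <- symrange n) F k = \sum_(0 <= i < (2 * n).+1) F (i%:Z - n%:Z).
Proof. by rewrite /symrange big_map /index_iota subn0. Qed.

Lemma big_symrangeS (V : zmodType) n (F : int -> V) :
  \sum_(k <- symrange n.+1) F k
  = \sum_(k <- symrange n) F k + (F n.+1%:Z + F (- n.+1%:Z)).
Proof.
rewrite !big_symrange_nat.
have -> : ((2 * n.+1).+1 = (2 * n).+1.+2)%N by lia.
rewrite big_nat_recl // big_nat_recr //= [LHS]addrC -addrA.
congr (_ + (F _ + F _)); [|lia..].
by apply: eq_bigr => i _; congr F; lia.
Qed.

Lemma big_symrange (V : zmodType) n (F : int -> V) :
  \sum_(k <- symrange n) F k = F 0 + \sum_(1 <= k < n.+1) (F k%:Z + F (- k%:Z)).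
Proof.
elim: n => [|n IH]; first by rewrite big_nil addr0 /symrange /= big_seq1.
by rewrite big_symrangeS IH [in RHS]big_nat_recr //= -[LHS]addrA.
Qed.

Lemma big_symrange_widen (V : zmodType) n m (F : int -> V) : (n <= m)%N ->
  (forall k, n%:Z < `|k| -> F k = 0) ->
  \sum_(k <- symrange m) F k = \sum_(k <- symrange n) F k.
Proof.
move=> /subnKC <- F0; elim: (m - n)%N => [|i IH]; first by rewrite addn0.
by rewrite addnS big_symrangeS IH !F0 ?addr0 //; lia.
Qed.

Lemma big_symrange_flip d n (F : int -> algC) : (0 < d)%N ->
  (forall k, n%:Z < `|k| -> F k = 0) ->
  (forall k, F (quot_flip d k) = - F k) ->
  \sum_(k <- symrange n) F k = 0.
Proof.
(* The interval from -N to N - 1 consists of whole blocks of length d, with quotients -(n+1), ...,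
   n, and is therefore stable under the flip. The added terms and the last one, k = N, vanish. *)
move=> d0 F0 Fflip; pose N := (n.+1 * d)%N.
rewrite -(@big_symrange_widen _ n N) //; last by rewrite /N; nia.
rewrite big_symrange_nat big_nat_recr //=.
rewrite [F _]F0 ?addr0; last by rewrite /N; nia.
rewrite big_mkord; set G := (X in \sum_i X i).
(* For i = k + N the quotient is l + n + 1, so l -> -1 - l becomes i/d -> 2n + 1 - i/d. *)
have sgP (i : 'I_(2 * N)) : ((2 * n + 1 - i %/ d) * d + i %% d < 2 * N)%N.
  have := ltn_pmod i d0; have := leq_subr (i %/ d) (2 * n + 1).
  by move: (_ - _)%N (_ %% _)%N => x y; rewrite /N; nia.
pose sg (i : 'I_(2 * N)) := Ordinal (sgP i).
have quo_le (i : 'I_(2 * N)) : (i %/ d <= 2 * n + 1)%N.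
  by rewrite -ltnS ltn_divLR // (leq_trans (ltn_ord i)) // /N; nia.
have sgK : involutive sg.
  move=> i; apply: val_inj => /=.
  rewrite divnMDl // modnMDl modn_mod (divn_small (ltn_pmod i d0)) addn0.
  by rewrite subKn // -divn_eq.
have GN i : G (sg i) = - G i.
  rewrite /G -Fflip; congr F; rewrite /quot_flip /=.
  have iE := divn_eq i d; have := quo_le i; have := ltn_pmod i d0.
  move: (i %/ d)%N (i %% d)%N iE => u v iE vd ud.
  have kE : i%:Z - N%:Z = (u%:Z - n%:Z - 1) * d%:Z + v%:Z by rewrite iE /N; nia.
  have d1 : d%:Z != 0 by lia.
  rewrite kE divzMDl // modzMDl divz_small ?modz_small ?addr0; [|lia..].
  by rewrite PoszD PoszM -subzn // /N; nia.
have E : \sum_i G i = - \sum_i G i.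
  by rewrite {1}(reindex_inj (inv_inj sgK)) -sumrN; apply: eq_bigr => i _; exact: GN.
have : (\sum_i G i) *+ 2 == 0 by rewrite mulr2n {1}E addNr.
by rewrite mulrn_eq0 => /eqP.
Qed.

(** * The alternating sums: vanishing by the flip, and a lower bound for multiplicities *)

Definition altterm (a b c r s t : nat) (k : int) : {poly int} :=
  (-1) ^ k * 'X^(zbin2 k) * qbin (2 * a) (a%:Z + k) ^+ r
    * qbin (2 * b) (b%:Z + k) ^+ s * qbin (2 * c) (c%:Z + k) ^+ t.

Definition altsum (a b c r s t : nat) : {poly int} :=
  \sum_(k <- symrange c) altterm a b c r s t k.

Lemma altterm_at z a b c r s t k : (zmap (altterm a b c r s t k)).[z]
  = qsign z k * qbin_at z (2 * a) (a%:Z + k) ^+ r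
    * qbin_at z (2 * b) (b%:Z + k) ^+ s * qbin_at z (2 * c) (c%:Z + k) ^+ t.
Proof.
rewrite /altterm /qsign !signz !rmorphM !rmorphXn /= map_polyX rmorphN rmorph1 /=.
by rewrite !(hornerM, horner_exp, hornerX, hornerN, hornerC).
Qed.

Lemma altsum_root_of_large_residues d z a b c r s t :
  d.-primitive_root z -> (0 < t)%N ->
  (d <= 2 * (a %% d))%N -> (d <= 2 * (b %% d))%N -> (d <= 2 * (c %% d))%N ->
  root (zmap (altsum a b c r s t)) z.
Proof.
move=> zP t0 ha hb hc; rewrite /root /altsum rmorph_sum horner_sum /=; apply/eqP.
apply: (big_symrange_flip (prim_order_gt0 zP)) => k; rewrite !altterm_at.
  move=> kc; rewrite (_ : qbin_at z (2 * c) (c%:Z + k) = 0).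
    by rewrite expr0n eqn0Ngt t0 mulr0.
  have [k0|k0] : c%:Z + k < 0 \/ (2 * c)%N%:Z < c%:Z + k by lia.
    exact: qbin_at_lt0.
  exact: qbin_at_gt.
by rewrite !qbin_at_flip // (qsign_flip _ zP) !mulNr.
Qed.

(** The q-binomial coefficients are even in k, and binom(-k, 2) = binom(k, 2) + k. *)
Lemma altterm_pair a b c r s t (k : nat) :
  (k <= a)%N -> (k <= b)%N -> (k <= c)%N ->
  altterm a b c r s t k%:Z + altterm a b c r s t (- k%:Z)
  = altterm a b c r s t k%:Z * (1 + 'X^k).
Proof.
have opp m : (k <= m)%N -> qbin (2 * m) (m%:Z - k%:Z) = qbin (2 * m) (m%:Z + k%:Z).
  move=> km; rewrite subzn // -PoszD -(@qbin_sub _ (m + k)%N); last by lia.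
  by congr qbin; lia.
move=> ka kb kc; rewrite /altterm !opp // !signz abszN.
have -> : zbin2 (- k%:Z) = (zbin2 k + k)%N.
  have := zbin2E k; have := zbin2E (- k%:Z); nia.
rewrite exprD; ring.
Qed.

(** For k at most a, this is the multiplicity of a primitive d-th root of unity in [2a; a + k], by
    [mup_qbin]. *)
Definition carry (d a k : nat) : bool := (d <= (a + k) %% d + (a - k) %% d)%N.

(** With v and kap the residues of a and k, the two residues in [carry] add up to 2v, minus d if v +
    kap reaches d, plus d if kap > v. *)
Lemma carryE d a k : (0 < d)%N -> (k <= a)%N ->
  carry d a k = ~~ (if (d <= 2 * (a %% d))%N
                    then (d <= a %% d + k %% d)%N && (k %% d <= a %% d)%N
                    else (k %% d <= a %% d)%N || (d <= a %% d + k %% d)%N).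
Proof.
move=> d0 ka; have := modnD (a - k) k d0; rewrite subnK // /carry modnD //.
have := ltn_pmod a d0; have := ltn_pmod k d0; have := ltn_pmod (a - k) d0.
move: (a %% d)%N (k %% d)%N ((a - k) %% d)%N => v kap x xd kd vd.
case: (leqP d (x + kap)) => h1; case: (leqP d (v + kap)) => h2;
  case: (leqP d (2 * v)) => h3; case: (leqP kap v) => h4;
  rewrite ?mul1n ?mul0n /=; lia.
Qed.

Lemma altsum_mup d z a b c r s t e : d.-primitive_root z ->
  (c <= a)%N -> (c <= b)%N -> altsum a b c r s t != 0 ->
  (forall k, (k <= c)%N -> (e <= r * carry d a k + s * carry d b k
      + t * carry d c k + ((k %% d).*2 == d))%N) ->
  (e <= mup z (zmap (altsum a b c r s t)))%N.
Proof.
move=> zP ca cb S0 He; rewrite mup_geq ?zmap_eq0 //.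
pose G k := zmap (altterm a b c r s t k%:Z * (1 + 'X^k)).
have Gdvd k : (k <= c)%N -> ('X - z%:P) ^+ e %| G k.
  move=> kc; apply: dvdp_trans (dvdp_exp2l _ (He k kc)) _.
  have bin m i : (k <= m)%N -> ('X - z%:P) ^+ (i * carry d m k)
      %| zmap (qbin (2 * m) (m%:Z + k%:Z) ^+ i).
    move=> km; rewrite -PoszD rmorphXn /= mulnC exprM; apply: dvdp_exp2r.
    rewrite -mup_geq ?zmap_eq0 ?qbin_neq0 ?(mup_qbin zP); [|lia..].
    by rewrite /carry (_ : 2 * m - (m + k) = m - k)%N ?leqnn //; lia.
  rewrite !exprD /G /altterm !rmorphM /= -!mulrA.
  apply: dvdp_mull; apply: dvdp_mull; apply: dvdp_mul; first by apply: bin; lia.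
  apply: dvdp_mul; first by apply: bin; lia.
  apply: dvdp_mul; first exact: bin.
  (* If k is d/2 modulo d, then z^k is a square root of 1 other than 1, so 1 + z^k = 0. *)
  case: eqP => kd; last by rewrite dvd1p.
  rewrite dvdp_XsubCl /root rmorphD rmorph1 /= map_polyXn !hornerE.
  rewrite -(prim_expr_mod zP) addrC addr_eq0.
  have : (z ^+ (k %% d)) ^+ 2 == 1 by rewrite -exprM muln2 kd prim_expr_order.
  rewrite sqrf_eq1 => /orP[|//]; rewrite -(prim_order_dvd zP) => /dvdn_leq.
  by have := prim_order_gt0 zP; lia.
rewrite /altsum big_symrange rmorphD rmorph_sum /=; apply: dvdp_add; last first.
  rewrite big_nat; elim/big_ind: _ => [|x y|i /andP[_ ic]]; first exact: dvdp0.
    exact: dvdp_add.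
  by rewrite altterm_pair ?Gdvd //; lia.
(* The term k = 0 has no partner: [G 0] is twice that term, and 2 is invertible in [algC]. *)
have := Gdvd 0%N (leq0n _); rewrite /G rmorphM /= (_ : zmap (1 + 'X^0) = 2%:P).
  by rewrite mulrC mul_polyC dvdpZr // pnatr_eq0.
by rewrite expr0 rmorphD rmorph1 -polyC1 -polyCD.
Qed.

(** * Reduction of the congruences to multiplicities at primitive roots of unity *)

Definition only_unity_roots (p : {poly int}) : Prop :=
  lead_coef p \is a GRing.unit
  /\ forall z, (0 < mup z (zmap p))%N -> exists d, d.-primitive_root z.

Lemma only_unity_rootsM p q :
  only_unity_roots p -> only_unity_roots q -> only_unity_roots (p * q).
Proof.
move=> [up Hp] [uq Hq]; split=> [|z]; first by rewrite lead_coefM unitrM up.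
rewrite rmorphM mupM ?zmap_eq0 ?lead_unit_neq0 // addn_gt0.
by case/orP; [apply: Hp | apply: Hq].
Qed.

Lemma qbin_unity_roots m k : (k <= m)%N -> only_unity_roots (qbin m k%:Z).
Proof. by move=> km; split=> [|z]; [apply: qbin_lead_unit | apply: mup_qbin_prim]. Qed.

Lemma qnat_powM m a : qnat_pow m a * (1 - 'X^a) = 1 - 'X^(a * m).
Proof.
rewrite qnat_powE; elim: m => [|m IH]; first by rewrite big_ord0 muln0 subrr mul0r.
rewrite big_ord_recr mulrDl IH /= mulnS exprD; ring.
Qed.

Lemma mup_qnat_pow m a z : (0 < m)%N -> (0 < a)%N ->
  (mup z (zmap (qnat_pow m a)) + (z ^+ a == 1)%R = (z ^+ (a * m) == 1)%R)%N.
Proof.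
move=> m0 a0; have am0 : (0 < a * m)%N by rewrite muln_gt0 a0.
rewrite -!mup_1subXn //.
have Zx j : 1 - 'X^j = zmap (1 - 'X^j) by rewrite rmorphB rmorph1 /= map_polyXn.
have := lead_unit_neq0 (lead_unit_1subXn am0).
rewrite !Zx -qnat_powM rmorphM mulf_eq0 negb_or => /andP[q0 x0].
by rewrite mupM ?zmap_eq0.
Qed.

Lemma qnat_pow_unity_roots m a : (0 < m)%N -> (0 < a)%N ->
  only_unity_roots (qnat_pow m a).
Proof.
move=> m0 a0; have am0 : (0 < a * m)%N by rewrite muln_gt0 a0.
split=> [|z gt0].
  have := lead_unit_1subXn am0; rewrite -qnat_powM lead_coefM unitrM.
  by case/andP.
have := mup_qnat_pow z m0 a0; case: (z ^+ _ =P 1) => [za _|_].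
  by have [d dP _] := prim_order_exists a0 za; exists d.
case: eqP => [zam _|_]; last by lia.
by have [d dP _] := prim_order_exists am0 zam; exists d.
Qed.

(** [p] at q^(p^e) is the cyclotomic polynomial of order p^(e+1). *)
Lemma mup_qnat_pow_prime p e d z : prime p -> d.-primitive_root z ->
  mup z (zmap (qnat_pow p (p ^ e))) = (d == p ^ e.+1)%N.
Proof.
move=> pp zP; have p0 := prime_gt0 pp; have pe0 : (0 < p ^ e)%N by rewrite expn_gt0 p0.
have := mup_qnat_pow z p0 pe0; rewrite -!(prim_order_dvd zP) -expnSr.
have [->|ne] := eqVneq d (p ^ e.+1)%N.
  by rewrite dvdnn (dvdn_Pexp2l _ _ (prime_gt1 pp)) ltnn addn0.
case: (boolP (d %| p ^ e.+1)%N) => [/dvdn_pfactor-/(_ pp)[i ie dE]|_]; last by lia.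
have ie' : (i <= e)%N.
  by rewrite -ltnS ltn_neqAle ie andbT; apply: contraNneq ne => <-; rewrite dE.
by rewrite dE dvdn_exp2l //; lia.
Qed.

Lemma qdiv_congr0_of_mup B S M : only_unity_roots B -> only_unity_roots M ->
  (forall d z, d.-primitive_root z -> S != 0 ->
     (mup z (zmap M) + mup z (zmap B) <= mup z (zmap S))%N) ->
  qdiv_congr0 B S M.
Proof.
move=> uB uM le_mup; have [uMB rMB] := only_unity_rootsM uM uB.
have [H SE] : exists H, S = H * (M * B); last by exists H; rewrite SE mulrA.
apply: zdvd_of_mup => // z S0; case: (posnP (mup z (zmap (M * B)))) => [-> //|/rMB[d zP]].
by rewrite rmorphM mupM ?zmap_eq0 ?lead_unit_neq0 ?(le_mup d) //; [case: uM | case: uB].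
Qed.

(** * Multiplicity at least one: residues of the multiples of n modulo d *)

(* The residues kap of k modulo d for which [2a; a + k] does not vanish at a
   primitive d-th root of unity, v being the residue of a. *)
Definition carry_free (d v kap : nat) : Prop :=
  (d <= 2 * v /\ (d <= v + kap /\ kap <= v))%N
  \/ (2 * v < d /\ (kap <= v \/ d <= v + kap))%N.

Lemma carryF d a k : (0 < d)%N -> (k <= a)%N -> carry d a k = false ->
  carry_free d (a %% d) (k %% d).
Proof.
move=> d0 ka; rewrite carryE // => /negbFE.
case: (leqP d (2 * (a %% d))) => h; first by move/andP; left.
by move=> /orP; right.
Qed.

Lemma altsum_mup1 d z a b c r s t : d.-primitive_root z ->
  (0 < r)%N -> (0 < s)%N -> (0 < t)%N ->
  (c <= a)%N -> (c <= b)%N -> altsum a b c r s t != 0 ->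
  (forall k, (k <= c)%N -> carry d a k = false -> carry d b k = false ->
     carry d c k = false ->
     [&& d <= 2 * (a %% d), d <= 2 * (b %% d) & d <= 2 * (c %% d)]%N) ->
  (0 < mup z (zmap (altsum a b c r s t)))%N.
Proof.
move=> zP r0 s0 t0 ca cb S0; case: [&& _, _ & _] / and3P => [[ha hb hc] _ | _ H].
  by rewrite -XsubC_dvd ?zmap_eq0 // dvdp_XsubCl (altsum_root_of_large_residues _ _ zP).
apply: (altsum_mup zP) => // k kc; have := H k kc.
case: (carry d a k); case: (carry d b k); case: (carry d c k) => //=; lia.
Qed.

(** Makes the residue of i n linear in that of n, up to finitely many offsets j, so that linear
    arithmetic can settle each case. *)
Lemma modn_mul_cases i d n : (0 < d)%N -> (0 < i)%N ->
  exists2 j, (j < i)%N & ((i * n) %% d + j * d = i * (n %% d))%N.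
Proof.
move=> d0 i0; exists ((i * (n %% d)) %/ d)%N.
  by rewrite ltn_divLR // ltn_pmul2l // ltn_pmod.
by rewrite -modnMmr addnC -divn_eq.
Qed.

(* With x the fractional part of n / d, each hypothesis confines x to finitely
   many intervals, and two of the three conditions on k are incompatible on each
   of them except the last one, [5/6, 1[ (resp. [7/8, 1[ below). *)
Lemma large_residues6 d n k : (0 < d)%N -> (k <= n)%N ->
  (d <= n %% d + (5 * n) %% d)%N \/ (d <= 2 * ((3 * n) %% d))%N
    \/ (((3 * n) %% d = 0)%N /\ (0 < n %% d)%N) ->
  carry d (3 * n) k = false -> carry d (2 * n) k = false -> carry d n k = false ->
  [&& d <= 2 * ((3 * n) %% d), d <= 2 * ((2 * n) %% d) & d <= 2 * (n %% d)]%N.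
Proof.
move=> d0 kn H /carryF H3 /carryF H2 /carryF H1.
move: (H3 d0) (H2 d0) (H1 d0) => {H1 H2 H3}; rewrite /carry_free.
have [k2 k3] : (k <= 2 * n /\ k <= 3 * n)%N by lia.
move=> /(_ k3) + /(_ k2) + /(_ kn); move: H; have := ltn_pmod k d0; have := ltn_pmod n d0.
have [j2 j2l E2] := @modn_mul_cases 2 d n d0 isT.
have [j3 j3l E3] := @modn_mul_cases 3 d n d0 isT.
have [j5 j5l E5] := @modn_mul_cases 5 d n d0 isT.
have := ltn_pmod (3 * n) d0; have := ltn_pmod (5 * n) d0; have := ltn_pmod (2 * n) d0.
move: (n %% d)%N ((2 * n) %% d)%N ((3 * n) %% d)%N ((5 * n) %% d)%N (k %% d)%N E2 E3 E5.
move=> v v2 v3 v5 kap {kn k2 k3 n k}.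
case: j2 j2l => [|[|//]] _; case: j3 j3l => [|[|[|//]]] _;
case: j5 j5l => [|[|[|[|[|//]]]]] _; lia.
Qed.

Lemma large_residues8 d n k : (0 < d)%N -> (k <= n)%N ->
  (d <= (3 * n) %% d + (5 * n) %% d)%N ->
  carry d (4 * n) k = false -> carry d (2 * n) k = false -> carry d n k = false ->
  [&& d <= 2 * ((4 * n) %% d), d <= 2 * ((2 * n) %% d) & d <= 2 * (n %% d)]%N.
Proof.
move=> d0 kn H /carryF H3 /carryF H2 /carryF H1.
move: (H3 d0) (H2 d0) (H1 d0) => {H1 H2 H3}; rewrite /carry_free.
have [k2 k3] : (k <= 2 * n /\ k <= 4 * n)%N by lia.
move=> /(_ k3) + /(_ k2) + /(_ kn); move: H; have := ltn_pmod k d0; have := ltn_pmod n d0.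
have := ltn_pmod (4 * n) d0.
have [j2 j2l E2] := @modn_mul_cases 2 d n d0 isT.
have [j3 j3l E3] := @modn_mul_cases 3 d n d0 isT.
have [j4 j4l E4] := @modn_mul_cases 4 d n d0 isT.
have [j5 j5l E5] := @modn_mul_cases 5 d n d0 isT.
have := ltn_pmod (3 * n) d0; have := ltn_pmod (5 * n) d0; have := ltn_pmod (2 * n) d0.
move: (n %% d)%N ((2 * n) %% d)%N ((3 * n) %% d)%N ((4 * n) %% d)%N
  ((5 * n) %% d)%N (k %% d)%N E2 E3 E4 E5.
move=> v v2 v3 v4 v5 kap {kn k2 k3 n k}.
by case: j2 j2l => [|[|//]] _; case: j4 j4l => [|[|[|[|//]]]] _; try lia;
case: j3 j3l => [|[|[|//]]] _; try lia;
case: j5 j5l => [|[|[|[|[|//]]]]] _; lia.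
Qed.


(** * Multiplicity at least two at the order attached to the factor [2] *)

Lemma modn_scale c h m p : ((c * (h * m)) %% (p * h) = h * ((c * m) %% p))%N.
Proof. by rewrite mulnCA [(p * h)%N]mulnC muln_modr. Qed.

(** The last hypothesis provides one carry for every k. A second factor comes from 1 + q^k, from
    another carry, or from the exponent of the only q-binomial coefficient that carries. *)
Lemma altsum_mup2 d z a b c r s t va vb vc : d.-primitive_root z ->
  (0 < r)%N -> (0 < s)%N -> (0 < t)%N ->
  (c <= a)%N -> (c <= b)%N -> altsum a b c r s t != 0 ->
  (a %% d = va)%N -> (b %% d = vb)%N -> (c %% d = vc)%N ->
  (forall kap, (kap < d)%N -> kap.*2 = d \/
     ((carry_free d va kap -> carry_free d vb kap -> (1 < t)%N) /\
      (carry_free d va kap -> carry_free d vc kap -> (1 < s)%N) /\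
      (carry_free d vb kap -> carry_free d vc kap -> (1 < r)%N))) ->
  (forall kap, (kap < d)%N ->
     ~ (carry_free d va kap /\ carry_free d vb kap /\ carry_free d vc kap)) ->
  (1 < mup z (zmap (altsum a b c r s t)))%N.
Proof.
move=> zP r0 s0 t0 ca cb S0 <- <- <- H2 H3; have d0 := prim_order_gt0 zP.
apply: (altsum_mup zP) => // k kc.
have := carryF d0 (leq_trans kc ca); have := carryF d0 (leq_trans kc cb).
have := carryF d0 kc; have := H3 _ (ltn_pmod k d0).
case: (H2 _ (ltn_pmod k d0)) => [->|[]]; first rewrite eqxx;
  case: (carry d a k); case: (carry d b k); case: (carry d c k) => /=; intuition lia.
Qed.

Lemma odd_part n : (0 < n)%N ->
  exists2 m, (n = 2 ^ logn 2 n * m)%N & odd m.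
Proof.
move=> n0; have [m cm nE] := pfactor_coprime (isT : prime 2) n0.
by exists m; [rewrite mulnC -nE | rewrite -coprime2n].
Qed.

(** Modulo d = 2h, 3n and n are both h, so [6n; 3n + k] and [2n; n + k] carry unless kap = h. There
    [4n; 2n + k] carries and 1 + q^k vanishes. *)
Lemma altsum6_mup2 h m z r s t : (2 * h).-primitive_root z -> odd m ->
  (0 < r)%N -> (0 < s)%N -> (0 < t)%N ->
  let n := (h * m)%N in altsum (3 * n) (2 * n) n r s t != 0 ->
  (1 < mup z (zmap (altsum (3 * n) (2 * n) n r s t)))%N.
Proof.
move=> zP om r0 s0 t0 n S0; have d0 := prim_order_gt0 zP.
have E1 : (n %% (2 * h) = h)%N.
  by rewrite -[n]mul1n modn_scale (_ : (1 * m) %% 2 = 1)%N ?muln1 //; lia.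
have E2 : ((2 * n) %% (2 * h) = 0)%N.
  by rewrite modn_scale (_ : (2 * m) %% 2 = 0)%N ?muln0 //; lia.
have E3 : ((3 * n) %% (2 * h) = h)%N.
  by rewrite modn_scale (_ : (3 * m) %% 2 = 1)%N ?muln1 //; lia.
apply: (altsum_mup2 zP _ _ _ _ _ S0 E3 E2 E1) => // [||kap kd|kap kd]; [lia | lia | |];
  by rewrite /carry_free; lia.
Qed.

(** Modulo 2h, 4n and 2n are 0, so their coefficients carry unless kap = 0. There only [2n; n + k]
    carries, with exponent t. *)
Lemma altsum8_mup2_low h m z r s t : (2 * h).-primitive_root z -> odd m ->
  (0 < r)%N -> (0 < s)%N -> (1 < t)%N ->
  let n := (h * m)%N in altsum (4 * n) (2 * n) n r s t != 0 ->
  (1 < mup z (zmap (altsum (4 * n) (2 * n) n r s t)))%N.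
Proof.
move=> zP om r0 s0 t2 n S0; have d0 := prim_order_gt0 zP.
have E1 : (n %% (2 * h) = h)%N.
  by rewrite -[n]mul1n modn_scale (_ : (1 * m) %% 2 = 1)%N ?muln1 //; lia.
have E2 : ((2 * n) %% (2 * h) = 0)%N.
  by rewrite modn_scale (_ : (2 * m) %% 2 = 0)%N ?muln0 //; lia.
have E4 : ((4 * n) %% (2 * h) = 0)%N.
  by rewrite modn_scale (_ : (4 * m) %% 2 = 0)%N ?muln0 //; lia.
apply: (altsum_mup2 zP _ _ _ _ _ S0 E4 E2 E1) => // [|||kap kd|kap kd];
  [lia | lia | lia | |];
  by rewrite /carry_free; lia.
Qed.

(** Modulo 4h, [8n; 4n + k] is free of carry only at kap = 0, and [4n; 2n + k] only at kap = 2h =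
    d/2. For m = 1 modulo 4, only [4n; 2n + k] carries at kap = 0, whence s > 1; for m = 3,
    [2n; n + k] carries there too. *)
Lemma altsum8_mup2_mid h m z r s t : (4 * h).-primitive_root z -> odd m ->
  (0 < r)%N -> (0 < s)%N -> (0 < t)%N ->
  (1 < s)%N \/ ((1 < r)%N /\ (m %% 4 = 3)%N) ->
  let n := (h * m)%N in altsum (4 * n) (2 * n) n r s t != 0 ->
  (1 < mup z (zmap (altsum (4 * n) (2 * n) n r s t)))%N.
Proof.
move=> zP om r0 s0 t0 H n S0; have d0 := prim_order_gt0 zP.
have E1 : (n %% (4 * h) = h * (m %% 4))%N.
  by rewrite -[n]mul1n modn_scale mul1n.
have E2 : ((2 * n) %% (4 * h) = h * 2)%N.
  by rewrite modn_scale (_ : (2 * m) %% 4 = 2)%N //; lia.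
have E4 : ((4 * n) %% (4 * h) = 0)%N.
  by rewrite modn_scale (_ : (4 * m) %% 4 = 0)%N ?muln0 //; lia.
have : (m %% 4 = 1 \/ m %% 4 = 3)%N by lia.
move: (m %% 4)%N E1 H => x E1 H Hx.
apply: (altsum_mup2 zP _ _ _ _ _ S0 E4 E2 E1) => // [||kap kd|kap kd]; [lia | lia | |];
  by rewrite /carry_free; case: Hx H => ->; lia.
Qed.

(** Modulo 8h, [8n; 4n + k] carries unless kap = 4h = d/2. If n is h, it alone carries for kap near
    0 or d, whence r > 1. If n is 5h, no kap is free for both smaller coefficients. *)
Lemma altsum8_mup2_high h m z r s t : (8 * h).-primitive_root z -> (m %% 4 = 1)%N ->
  (1 < r)%N -> (0 < s)%N -> (0 < t)%N ->
  let n := (h * m)%N in altsum (4 * n) (2 * n) n r s t != 0 ->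
  (1 < mup z (zmap (altsum (4 * n) (2 * n) n r s t)))%N.
Proof.
move=> zP m1 r2 s0 t0 n S0; have d0 := prim_order_gt0 zP.
have E1 : (n %% (8 * h) = h * (m %% 8))%N.
  by rewrite -[n]mul1n modn_scale mul1n.
have E2 : ((2 * n) %% (8 * h) = h * 2)%N.
  by rewrite modn_scale (_ : (2 * m) %% 8 = 2)%N //; lia.
have E4 : ((4 * n) %% (8 * h) = h * 4)%N.
  by rewrite modn_scale (_ : (4 * m) %% 8 = 4)%N //; lia.
have : (m %% 8 = 1 \/ m %% 8 = 5)%N by lia.
move: (m %% 8)%N E1 => x E1 Hx.
apply: (altsum_mup2 zP _ _ _ _ _ S0 E4 E2 E1) => // [|||kap kd|kap kd];
  [lia | lia | lia | |];
  by rewrite /carry_free; case: Hx => ->; lia.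
Qed.

(** * The congruences, checked order by order *)

Unset Implicit Arguments.

Theorem theorem2 (n r s t : nat) (hn : (0 < n)%N) (hr : (0 < r)%N)
    (hs : (0 < s)%N) (ht : (0 < t)%N) :
  let alpha := logn 2 n in
  let beta := logn 3 n in
  let S6 : {poly int} :=
    \sum_(k <- symrange n) (-1) ^ k * 'X^(zbin2 k)
      * qbin (6 * n) ((3 * n)%:Z + k) ^+ r
      * qbin (4 * n) ((2 * n)%:Z + k) ^+ s
      * qbin (2 * n) (n%:Z + k) ^+ t in
  let S8 : {poly int} :=
    \sum_(k <- symrange n) (-1) ^ k * 'X^(zbin2 k)
      * qbin (8 * n) ((4 * n)%:Z + k) ^+ r
      * qbin (4 * n) ((2 * n)%:Z + k) ^+ s
      * qbin (2 * n) (n%:Z + k) ^+ t in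
  [/\ qdiv_congr0 (qbin (6 * n) n%:Z) S6 (qnat_pow 2 (2 ^ alpha)),
      qdiv_congr0 (qbin (6 * n) (3 * n)%:Z) S6
        (qnat_pow 2 (2 ^ alpha) * qnat_pow 3 (3 ^ beta))
    & [/\ (2 <= t)%N ->
            qdiv_congr0 (qbin (8 * n) (3 * n)%:Z) S8 (qnat_pow 2 (2 ^ alpha)),
          (2 <= s)%N
            \/ ((2 <= r)%N /\ (n = 3 * 2 ^ alpha %[mod 2 ^ (alpha + 2)])%N) ->
            qdiv_congr0 (qbin (8 * n) (3 * n)%:Z) S8
              (qnat_pow 2 (2 ^ (alpha + 1)))
        & (2 <= r)%N -> (n = 2 ^ alpha %[mod 2 ^ (alpha + 2)])%N ->
            qdiv_congr0 (qbin (8 * n) (3 * n)%:Z) S8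
              (qnat_pow 2 (2 ^ (alpha + 2)))]].
Proof.
move=> alpha beta S6 S8.
have -> : S6 = altsum (3 * n) (2 * n) n r s t by rewrite /altsum /altterm !mulnA.
have -> : S8 = altsum (4 * n) (2 * n) n r s t by rewrite /altsum /altterm !mulnA.
have [m nE om] := odd_part hn; rewrite -/alpha in nE.
(* The alternatives cover the orders of the roots of [6n; n], of [6n; 3n], and of the factor [3] of
   the modulus. *)
have low6 d z : d.-primitive_root z -> altsum (3 * n) (2 * n) n r s t != 0 ->
    (d <= n %% d + (5 * n) %% d)%N \/ (d <= 2 * ((3 * n) %% d))%N
      \/ (((3 * n) %% d = 0)%N /\ (0 < n %% d)%N) ->
    (0 < mup z (zmap (altsum (3 * n) (2 * n) n r s t)))%N.
  move=> zP S0 H; apply: (altsum_mup1 zP) => // [||k kn]; [lia | lia |].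
  exact: (large_residues6 (prim_order_gt0 zP) kn H).
have high6 d z : d.-primitive_root z -> altsum (3 * n) (2 * n) n r s t != 0 ->
    d = (2 ^ alpha.+1)%N -> (1 < mup z (zmap (altsum (3 * n) (2 * n) n r s t)))%N.
  rewrite expnS => + + dE; rewrite dE nE => zP S0; exact: (altsum6_mup2 zP).
(* Only at order 2^(e+1) can modulus and q-binomial coefficient both vanish, each at most simply;
   multiplicity two is enough there and one elsewhere. *)
have congr8 e : (forall z, (2 ^ e.+1).-primitive_root z ->
      altsum (4 * n) (2 * n) n r s t != 0 ->
      (1 < mup z (zmap (altsum (4 * n) (2 * n) n r s t)))%N) ->
    qdiv_congr0 (qbin (8 * n) (3 * n)%:Z) (altsum (4 * n) (2 * n) n r s t)
      (qnat_pow 2 (2 ^ e)).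
  move=> high8; apply: qdiv_congr0_of_mup.
  - by apply: qbin_unity_roots; lia.
  - by apply: qnat_pow_unity_roots; rewrite ?expn_gt0.
  move=> d z zP S0; rewrite (mup_qnat_pow_prime _ _ zP) // (mup_qbin zP); last by lia.
  rewrite (_ : 8 * n - 3 * n = 5 * n)%N; last by lia.
  case: (d =P _) => [dE|_]; last first.
    rewrite ?add0n; case: (leqP d _) => // H.
    apply: (altsum_mup1 zP) => // [||k kn]; [lia | lia |].
    exact: (large_residues8 (prim_order_gt0 zP) kn H).
  by apply: leq_trans (high8 z _ S0); rewrite -?dE // add1n ltnS leq_b1.
(* Cancelling 2^alpha turns the condition on n into one on its odd part m modulo 4. *)
have modm c : (c < 4)%N -> (n = c * 2 ^ alpha %[mod 2 ^ (alpha + 2)])%N -> (m %% 4 = c)%N.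
  move=> c4; rewrite addnC expnD (_ : 2 ^ 2 = 4)%N // [(c * _)%N]mulnC.
  rewrite {1}nE -[(2 ^ _ * m)%N]mul1n -[(2 ^ _ * c)%N]mul1n !modn_scale !mul1n.
  by move/eqP; rewrite eqn_pmul2l ?expn_gt0 // (modn_small c4) => /eqP.
split; [| |split].
- apply: qdiv_congr0_of_mup.
  + by apply: qbin_unity_roots; lia.
  + by apply: qnat_pow_unity_roots; rewrite ?expn_gt0.
  move=> d z zP S0; rewrite (mup_qnat_pow_prime _ _ zP) // (mup_qbin zP); last by lia.
  rewrite (_ : 6 * n - n = 5 * n)%N; last by lia.
  case: (d =P _) => [dE|_]; last first.
    by rewrite ?add0n; case: (leqP d _) => // H; apply: (low6 d) => //; left.
  by apply: leq_trans (high6 d z zP S0 dE); rewrite add1n ltnS leq_b1.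
- apply: qdiv_congr0_of_mup.
  + by apply: qbin_unity_roots; lia.
  + by apply: only_unity_rootsM; apply: qnat_pow_unity_roots; rewrite ?expn_gt0.
  move=> d z zP S0; have d0 := prim_order_gt0 zP.
  have q0 p e : prime p -> zmap (qnat_pow p (p ^ e)) != 0.
    move=> /prime_gt0 p0; rewrite zmap_eq0 lead_unit_neq0 //.
    by apply: (proj1 (qnat_pow_unity_roots _ _)); rewrite ?expn_gt0 p0.
  rewrite rmorphM mupM ?q0 // !(mup_qnat_pow_prime _ _ zP) // (mup_qbin zP); last by lia.
  rewrite (_ : 6 * n - 3 * n = 3 * n)%N; last by lia.
  case: (d =P (2 ^ _)%N) => [dE|_].
    (* The orders 2^(alpha+1) and 3^(beta+1) differ in parity, so the two factors of the modulus
       share no root. *)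
    have /negPf -> : d != (3 ^ beta.+1)%N.
      rewrite dE; apply/eqP => /(congr1 odd); rewrite !oddX /=; lia.
    by apply: leq_trans (high6 d z zP S0 dE); rewrite addn0 add1n ltnS leq_b1.
  case: (d =P (3 ^ _)%N) => [dE|_].
    (* Since d divides 3n, [6n; 3n] has no carry, and a simple root of the sum is enough. *)
    have d3n : (d %| 3 * n)%N by rewrite dE expnS dvdn_pmul2l // pfactor_dvdnn.
    have dn : ~~ (d %| n)%N by rewrite dE pfactor_dvdn // ltnn.
    move: (d3n) (dn); rewrite /dvdn -lt0n => /eqP n3 n1.
    rewrite n3 (leqNgt d) d0 /= addn0.
    by apply: (low6 d) => //; right; right.
  by rewrite ?add0n; case: (leqP d _) => // H; apply: (low6 d) => //; right; left; lia.
- move=> t2; apply: congr8 => z; rewrite expnS nE => zP S0.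
  exact: (altsum8_mup2_low zP).
- move=> H; apply: congr8 => z; rewrite addn1 !expnS mulnA nE => zP S0.
  apply: (altsum8_mup2_mid zP) => //.
  case: H => [|[r2 /modm->]]; [by left | by right | by []].
- move=> r2; rewrite -(mul1n (2 ^ alpha)%N) => /modm m1; apply: congr8 => z.
  rewrite addn2 !expnS !mulnA nE => zP S0.
  by apply: (altsum8_mup2_high zP) => //; apply: m1.
Qed.
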